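(* Let $D=(W_1,\dots,W_n)$ be i.i.d. records $W=(X,T,Y)$ from a law $P^\star$ satisfying unconfoundedness, $(Y(1),Y(0))\perp T\mid X$, and positivity, $e(X)=\Pr(T=1\mid X)\in[\eta,1-\eta]$ a.s. for some $\eta>0$; assume $Y\in[-B,B]$ and $\|\phi(X)\|_2\le\phi_{\max}$. Let $\tau=\mathbb{E}[Y(1)-Y(0)]$. Let $S\subset[m]$ be the set of retained workload coordinates and let $\widehat\tau_{\mathrm{est}}$ be a moment-map estimator, a function of the retained workload coordinates, satisfying the Lipschitz condition $$|\widehat\tau_{\mathrm{est}}(q)-\widehat\tau_{\mathrm{est}}(q')|\le L_{\mathrm{est}}\|q-q'\|_\infty$$ for the retained coordinates, for all workload vectors $q,q'$ in its domain. Let $\widetilde q$ be the Gaussian-mechanism release of $q(D)$ with parameters $(\varepsilon,\delta)$, let $P^{\mathrm{syn}}$ be the reconstruction solver's output distribution computed from $\widetilde q$, and let $\widehat\tau^{\mathrm{syn}}$ be the empirical estimate of $\widehat\tau_{\mathrm{est}}\{q(P^{\mathrm{syn}})\}$ formed from $n_{\mathrm{syn}}$ i.i.d. draws from $P^{\mathrm{syn}}$. Then $$|\widehat\tau^{\mathrm{syn}}-\tau|\le O_p\bigl(L_{\mathrm{est}}n^{-1/2}\bigr)+O_p\!\left(\frac{L_{\mathrm{est}}H_q\sqrt{\log m\,\log(1/\delta)}}{n\varepsilon}\right)+\mathrm{Approx}(\phi;S)+O_p\bigl(n_{\mathrm{syn}}^{-1/2}\bigr)+\mathrm{CalGap}(S,\sigma).$$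 If $P^{\mathrm{syn}}$ satisfies the constraints exactly (i.e. $q_a(P^{\mathrm{syn}})=\widetilde q_a$ for all $a\in S$), then the term $\mathrm{CalGap}(S,\sigma)$ vanishes and the bound holds with the first four terms only.
   Context: $Y(1),Y(0)$ are potential outcomes, $T\in\{0,1\}$ is treatment, $Y=Y(T)$, and $\phi:\mathcal X\to\mathbb{R}^p$ is a feature map. The causal workload consists of $m=4p$ real query functions $h_a(W)$, $a\in[m]$, namely the coordinates of $\mathbf 1\{T=t\}\phi(X)$ and $\mathbf 1\{T=t\}Y\phi(X)$, $t\in\{0,1\}$ (possibly extended by further bounded queries, with $m$ the total number). Its answers are $q_a(D)=n^{-1}\sum_ih_a(W_i)$ on a dataset and $q_a(P)=\mathbb{E}_P h_a(W)$ under a distribution $P$; $q^\star=q(P^\star)$. $H_q$ is a bound with $\|h(W)\|_2\le H_q$ for all records (for the base workload $H_q=\phi_{\max}\sqrt{1+B^2}$). The Gaussian mechanism releases $\widetilde q=q(D)+Z$, $Z\sim\mathcal N(0,\sigma^2I_m)$, $\sigma=\Delta_2\sqrt{2\log(1.25/\delta)}/\varepsilon$, where $\Delta_2\le 2H_q/n$ is the $\ell_2$ sensitivity of $q$ under replacement of one record. The solver output $P^{\mathrm{syn}}$ is a distribution over records computed from $\widetilde q$ by (approximately) minimizing $\mathrm{KL}(P\|P_0)$ subject to $q_a(P)=\widetilde q_a$ for $a\in S$, with $P_0$ a reference distribution; its supported records obey the same bounds on $Y$ and $\phi(X)$. The domain of $\widehat\tau_{\mathrm{est}}$ contains $q^\star$,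 $q(D)$, $\widetilde q$, $q(P^{\mathrm{syn}})$ and the workload answer $q(D^{\mathrm{syn}})$ of the synthetic sample $D^{\mathrm{syn}}$ of size $n_{\mathrm{syn}}$; the empirical version is $\widehat\tau^{\mathrm{syn}}=\widehat\tau_{\mathrm{est}}\{q(D^{\mathrm{syn}})\}$. $\Pi_S v=(v_a:a\in S)$ is coordinate projection and $\mathrm{CalGap}(S,\sigma):=L_{\mathrm{est}}\,\|\Pi_S\{\widetilde q-q(P^{\mathrm{syn}})\}\|_2$. $\mathrm{Approx}(\phi;S):=|\tau-\tau_{\phi,S}|$ is the approximation error of representing the outcome regressions $m_t(x)=\mathbb{E}[Y\mid T=t,X=x]$ and propensity $e(x)$ with the retained workload coordinates, where $\tau_{\phi,S}=\widehat\tau_{\mathrm{est}}(q^\star)$ is the target represented by those coordinates. $O_p$ statements are as $n,n_{\mathrm{syn}}\to\infty$ with the workload, its bounds and $L_{\mathrm{est}}$ fixed ($\delta$ bounded away from 1); the Monte Carlo $O_p$ may absorb $L_{\mathrm{est}}$. *)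

(* Defs.v *)
From HB Require Import structures.
From mathcomp Require Import all_boot all_order all_algebra.
From mathcomp Require Import all_classical all_reals all_analysis.

Set Implicit Arguments.
Unset Strict Implicit.
Unset Printing Implicit Defensive.

Import Order.TTheory GRing.Theory Num.Theory.
Import numFieldNormedType.Exports.

Local Open Scope classical_set_scope.
Local Open Scope ring_scope.

Definition norm2 (R : realType) (I : finType) (v : I -> R) : R :=
  Num.sqrt (\sum_i v i ^+ 2).

Definition normoo (R : realType) (I : finType) (v : I -> R) : R :=
  \big[Num.max/0]_i `|v i|.

Definition tadd (R : realType) m (u v : m.-tuple R) : m.-tuple R :=
  [tuple tnth u a + tnth v a | a < m].

Definition tsub (R : realType) m (u v : m.-tuple R) : m.-tuple R :=
  [tuple tnth u a - tnth v a | a < m].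

Definition proj (R : realType) m (S : {set 'I_m}) (v : m.-tuple R) :
    {a : 'I_m | a \in S} -> R :=
  fun a => tnth v (val a).
Arguments proj {R m} S v a.

Section probability_notions.
Context (R : realType).

(* [Z] has law [Q^{\otimes N}], i.e. its components are i.i.d. with law [Q]. *)
Definition iid_sample d (Omega : measurableType d) (P : probability Omega R)
    d' (T : measurableType d') (Q : set T -> \bar R)
    N (Z : Omega -> N.-tuple T) : Prop :=
  forall A : 'I_N -> set T, (forall i, measurable (A i)) ->
    P [set o | forall i, A i (tnth (Z o) i)] = (\prod_(i < N) Q (A i))%E.

(* Given [V], the components of [Z] are i.i.d. draws from the random
   distribution [K V]. *)
Definition iid_draws_given d (Omega : measurableType d)
    (P : probability Omega R)
    d1 (T1 : measurableType d1) d2 (T2 : measurableType d2)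
    (V : Omega -> T1) (K : T1 -> pprobability T2 R)
    N (Z : Omega -> N.-tuple T2) : Prop :=
  forall (A : set T1) (B : 'I_N -> set T2),
    measurable A -> (forall j, measurable (B j)) ->
    P (V @^-1` A `&` [set o | forall j, B j (tnth (Z o) j)]) =
    (\int[P]_(o in V @^-1` A) \prod_(j < N) K (V o) (B j))%E.

Definition independent_rv d (Omega : measurableType d)
    (P : probability Omega R)
    d1 (T1 : measurableType d1) d2 (T2 : measurableType d2)
    (U : Omega -> T1) (V : Omega -> T2) : Prop :=
  forall (A : set T1) (B : set T2), measurable A -> measurable B ->
    P (U @^-1` A `&` V @^-1` B) = (P (U @^-1` A) * P (V @^-1` B))%E.

(* [g] is a version of [x |-> P (E | X = x)]. *)
Definition is_cond_prob d (Omega : measurableType d) (P : probability Omega R)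
    dX (TX : measurableType dX) (X : Omega -> TX)
    (E : set Omega) (g : TX -> R) : Prop :=
  [/\ measurable_fun setT g,
      P.-integrable setT (fun o => (g (X o))%:E) &
      forall A, measurable A ->
        (\int[P]_(o in X @^-1` A) (g (X o))%:E = P (E `&` X @^-1` A))%E].

(* Versions of these conditional probabilities exist and agree almost surely,
   so it does not matter which ones are taken. *)
Definition cond_independent d (Omega : measurableType d)
    (P : probability Omega R) d1 (T1 : measurableType d1)
    d2 (T2 : measurableType d2) dX (TX : measurableType dX)
    (U : Omega -> T1) (V : Omega -> T2) (X : Omega -> TX) : Prop :=
  forall (A : set T1) (B : set T2), measurable A -> measurable B ->
  forall gU gV : TX -> R,
    is_cond_prob P X (U @^-1` A) gU -> is_cond_prob P X (V @^-1` B) gV ->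
    is_cond_prob P X (U @^-1` A `&` V @^-1` B) (fun x => gU x * gV x).

(* The law N(0, s^2) as the law of [s * xi] with [xi] standard normal:
   [normal_prob 0 0] is not the Dirac mass at 0, and [s = 0] is allowed. *)
Definition centered_gaussian (s : R) : set R -> \bar R :=
  pushforward (normal_prob 0 1) (fun x : R => s * x).

Definition KL d (T : measurableType d) (P Q : probability T R) : \bar R :=
  if `[< P `<< Q >] then
    (\int[P]_x
       (ln (fine (Radon_Nikodym (charge_of_finite_measure P) Q x)))%:E)%E
  else +oo%E.

(* [X n N = O_p (r n N)] as [n, N -> oo]. *)
Definition bigOp d (Omega : measurableType d) (P : probability Omega R)
    (X : nat -> nat -> Omega -> R) (r : nat -> nat -> R) : Prop :=
  forall alpha : R, 0 < alpha ->
  exists2 M : R, 0 < M &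
    \forall n \near \oo & N \near \oo,
      (P [set o | (M * r n N < `|X n N o|)%R] <= alpha%:E)%E.

End probability_notions.

(* A record is [(x, t, y)], with [t : bool] the treatment. *)
Notation record X R := (X * bool * R)%type.

Section observed_records.
Context (R : realType) d (Omega : measurableType d) (P : probability Omega R)
  dX (TX : measurableType dX).
Variables (X : {RV P >-> TX}) (T : {RV P >-> bool}) (Y : bool -> {RV P >-> R}).

(* [Y t] is the potential outcome Y(t); the observed outcome is Y(T). *)
Definition observed (o : Omega) : record TX R := (X o, T o, Y (T o) o).

Lemma measurable_observed : measurable_fun setT observed.
Proof.
apply: measurable_fun_pair; first exact: measurable_fun_pair.
rewrite (_ : (fun _ => _) = (fun o => if T o then Y true o else Y false o)).
  exact: measurable_fun_ifT.
by apply/funext => o; case: (T o).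
Qed.

HB.instance Definition _ :=
  isMeasurableFun.Build _ _ _ _ observed measurable_observed.

Definition observed_law : probability (record TX R) R :=
  distribution P observed.

Definition average_treatment_effect : R :=
  fine ('E_P[Y true \- Y false])%E.

End observed_records.

Section workload.
Context (R : realType) dX (TX : measurableType dX) (p k : nat).
Variables (phi : TX -> p.-tuple R) (extra : record TX R -> k.-tuple R).
Variables (B phimax : R).

Definition arm_features (t : bool) (w : record TX R) : p.-tuple R :=
  [tuple (w.1.2 == t)%:R * tnth (phi w.1.1) j | j < p].

Definition arm_outcomes (t : bool) (w : record TX R) : p.-tuple R :=
  [tuple (w.1.2 == t)%:R * w.2 * tnth (phi w.1.1) j | j < p].

Definition workload_size : nat := (p + p + (p + p) + k)%N.

(* The [4 p] causal queries followed by [k] further ones. *)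
Definition workload (w : record TX R) : workload_size.-tuple R :=
  [tuple of ((arm_features false w ++ arm_outcomes false w) ++
             (arm_features true w ++ arm_outcomes true w)) ++ extra w].

Definition valid_record : set (record TX R) :=
  [set w | `|w.2| <= B /\ norm2 (tnth (phi w.1.1)) <= phimax].

End workload.

Section answers.
Context (R : realType) d (T : measurableType d) (m : nat).
Variable h : T -> m.-tuple R.

Definition q_data n (D : n.-tuple T) : m.-tuple R :=
  [tuple n%:R^-1 * \sum_(i < n) tnth (h (tnth D i)) a | a < m].

Definition q_law (P : probability T R) : m.-tuple R :=
  [tuple \int[P]_w tnth (h w) a | a < m].

(* The l2 sensitivity of [q_data] under replacement of one record, over
   datasets with records in [valid]. *)
Definition sensitivity (valid : set T) (n : nat) : R :=
  sup [set s | exists D D' : n.-tuple T,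
    [/\ forall i, valid (tnth D i), forall i, valid (tnth D' i),
        exists i, forall j, j != i -> tnth D j = tnth D' j &
        s = norm2 (tnth (tsub (q_data D) (q_data D')))]].

Definition gaussian_mechanism_scale (valid : set T) (n : nat)
    (eps delta : R) : R :=
  sensitivity valid n * Num.sqrt (2 * ln (125%:R / 100%:R / delta)) / eps.

(* [P] solves, up to an error [rho] in each constraint and a loss [kappa] in
   the objective, the problem of minimizing KL(P || P0) among the
   distributions over valid records with [q_a(P) = v_a] for [a] in [S]. *)
Definition approx_KL_projection (valid : set T) (P0 : probability T R)
    (S : {set 'I_m}) (v : m.-tuple R) (rho kappa : R) (P : probability T R) :
    Prop :=
  [/\ {ae P, forall w, valid w},
      forall a, a \in S -> `|tnth (q_law P) a - tnth v a| <= rho &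
      forall P' : probability T R,
        {ae P', forall w, valid w} ->
        (forall a, a \in S -> tnth (q_law P') a = tnth v a) ->
        (KL P P0 <= KL P' P0 + kappa%:E)%E].

End answers.

Section estimator.
Context (R : realType) (m : nat).

(* [est] is a function on [dom] of the coordinates in [S] only, and is
   [L]-Lipschitz in them for the sup norm. *)
Definition moment_map_estimator (dom : set (m.-tuple R)) (S : {set 'I_m})
    (L : R) (est : m.-tuple R -> R) : Prop :=
  (forall q q', dom q -> dom q' -> proj S q = proj S q' -> est q = est q') /\
  (forall q q', dom q -> dom q' ->
    `|est q - est q'| <= L * normoo (proj S (tsub q q'))).

(* [est qstar] is the target tau_{phi,S} represented by the retained
   coordinates. *)
Definition Approx (tau : R) (est : m.-tuple R -> R) (qstar : m.-tuple R) : R :=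
  `|tau - est qstar|.

Definition CalGap (L : R) (S : {set 'I_m}) (qtilde qsyn : m.-tuple R) : R :=
  L * norm2 (proj S (tsub qtilde qsyn)).

End estimator.

(* Main.v *)
(** The error of the synthetic estimate splits along
    [q(Dsyn) -> q(Psyn) -> qtilde -> q(D) -> qstar -> tau]: each of the first
    four steps costs [Lest] times a sup norm, the last one is the approximation
    error, and the step [q(Psyn) -> qtilde] is the calibration gap.

    The two sampling steps are instances of one bound: if, given [V], the
    [Z_j] are i.i.d. draws from [K V] and [0 <= g <= c], then the mean of the
    [g (Z_j)] differs from the mean of [g] under [K V] by a quantity of second
    moment at most [c^2 / N]; unconditional i.i.d. data are the case of a
    trivial [V]. Independence is given on events only; it is carried over to
    [g] by comparing functionals [g |-> E[w (int g dk)]] which agree on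
    indicators. Queries are replaced by bounded ones, equal to them on valid
    records. The noise step only uses the tightness of the standard normal
    law, since the workload is fixed. *)

Require Import Defs.
From HB Require Import structures.
From mathcomp Require Import all_boot all_order all_algebra.
From mathcomp Require Import all_classical all_reals all_analysis.
From mathcomp Require Import ring lra zify.

Import Order.TTheory GRing.Theory Num.Theory.
Import numFieldNormedType.Exports.
Import measurable_realfun.

Local Open Scope classical_set_scope.
Local Open Scope ring_scope.

(** * Mixtures of kernels *)

Section mixture.
Local Open Scope ereal_scope.
Context {R : realType} {d d' : measure_display} {Om : measurableType d}
  {T : measurableType d'} (mu : {measure set Om -> \bar R}).
Import HBNNSimple.

(** For the Dirac kernel at a random point this is a joint moment of [w] and of [g] at that point;
    for a kernel of conditional laws it is the moment obtained by conditioning first. Independence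
    equates two such functionals. *)
Definition mixture (w : Om -> R) (k : Om -> {measure set T -> \bar R})
  (g : T -> \bar R) : \bar R := \int[mu]_o ((w o)%:E * \int[k o]_y g y).

Section mixture_theory.
Variables (w : Om -> R) (k : Om -> {measure set T -> \bar R}).
Hypothesis w0 : forall o, (0 <= w o)%R.
Hypothesis mw : measurable_fun [set: Om] w.
Hypothesis mk : forall U, measurable U -> measurable_fun [set: Om] (k ^~ U).

Let measurable_integrand (g : T -> \bar R) : (forall y, 0 <= g y) ->
  measurable_fun [set: T] g ->
  measurable_fun [set: Om] (fun o => (w o)%:E * \int[k o]_y g y).
Proof.
move=> g0 mg; apply: emeasurable_funM; first exact/measurable_EFinP.
exact: measurable_fun_integral_kernel.
Qed.

(** A simple function is the sum of its values times the indicators of its level sets, so linearity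
    reduces its mixture to events. *)
Lemma mixture_nnsfun (f : {nnsfun T >-> R})
    (s : seq R := finmap.enum_fset (fset_set (f @` [set: T]))) :
  mixture w k (EFin \o f) = \sum_(i < size s)
    (s`_i)%:E * \int[mu]_o ((w o)%:E * k o (f @^-1` [set s`_i])).
Proof.
have s0 (i : 'I_(size s)) : (0 <= s`_i)%R.
  have : s`_i \in s by exact: mem_nth.
  by rewrite /s /= in_fset_set// inE => -[x _ <-].
have mA (i : 'I_(size s)) : measurable (f @^-1` [set s`_i]) by [].
transitivity (\int[mu]_o \sum_(i < size s)
    ((s`_i)%:E * ((w o)%:E * k o (f @^-1` [set s`_i])))).
  apply: eq_integral => o _.
  transitivity
      ((w o)%:E * \sum_(i < size s) (s`_i)%:E * k o (f @^-1` [set s`_i])).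
    congr (_ * _); transitivity (\int[k o]_y \sum_(i < size s)
        ((s`_i)%:E * (\1_(f @^-1` [set s`_i]) y)%:E)).
      by apply: eq_integral => y _; rewrite /= [f y]fimfunEord -sumEFin.
    rewrite ge0_integral_sum//=.
    - apply: eq_bigr => i _; rewrite ge0_integralZl_EFin//.
      + by rewrite integral_indic// setIT.
      + exact/measurable_EFinP.
    - by move=> i; apply: measurable_funeM; exact/measurable_EFinP.
    - by move=> i y _; rewrite mule_ge0 ?lee_fin.
  rewrite ge0_sume_distrr//; last by move=> i _; rewrite mule_ge0 ?lee_fin.
  by apply: eq_bigr => i _; rewrite muleCA.
rewrite ge0_integral_sum//=.
- apply: eq_bigr => i _; rewrite ge0_integralZl_EFin//.
  + by move=> o _; rewrite mule_ge0 ?lee_fin.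
  + by apply: emeasurable_funM; [exact/measurable_EFinP|exact: mk].
- move=> i; apply: measurable_funeM.
  by apply: emeasurable_funM; [exact/measurable_EFinP|exact: mk].
- by move=> i o _; rewrite 2?mule_ge0 ?lee_fin.
Qed.

(** Monotone convergence applied twice, to the inner integrals and then to the outer one; the sign
    of [w] keeps the outer sequence nondecreasing. *)
Lemma mixture_cvg (g : T -> \bar R) (mg : measurable_fun [set: T] g) :
  (forall y, 0 <= g y) ->
  mixture w k g =
  limn (fun n => mixture w k (EFin \o nnsfun_approx measurableT mg n)).
Proof.
move=> g0; pose f_ := nnsfun_approx measurableT mg.
have mf n : measurable_fun [set: T] (EFin \o f_ n) by exact/measurable_EFinP.
have f0 n y : 0 <= (EFin \o f_ n) y by rewrite lee_fin.
have ndf y m n : (m <= n)%N -> (f_ m y)%:E <= (f_ n y)%:E.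
  by move=> mn; rewrite lee_fin; exact/lefP/nd_nnsfun_approx.
have ndI o m n : (m <= n)%N ->
    \int[k o]_y (f_ m y)%:E <= \int[k o]_y (f_ n y)%:E.
  move=> mn; apply: ge0_le_integral => //.
  - by move=> y _; exact: f0.
  - exact: mf.
  - exact: mf.
  - by move=> y _; exact: ndf.
rewrite -monotone_convergence//.
- apply: eq_integral => o _.
  transitivity ((w o)%:E * limn (fun n => \int[k o]_y (f_ n y)%:E)).
    congr (_ * _); rewrite -monotone_convergence//.
    - apply: eq_integral => y _; apply/esym/cvg_lim => //.
      exact: cvg_nnsfun_approx.
    - by move=> n y _; exact: f0.
    - by move=> y _ m n; exact: ndf.
  apply/esym/cvg_lim => //; apply: cvgeZl => //.
    by apply: ereal_nondecreasing_is_cvgn => m n; exact: ndI.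
- by move=> n; exact: measurable_integrand.
- by move=> n o _; rewrite mule_ge0 ?lee_fin//; apply: integral_ge0.
- by move=> o _ m n mn; rewrite lee_wpmul2l ?lee_fin// ndI.
Qed.

End mixture_theory.

(** Transfers an identity from events to functions, through simple functions and monotone limits.
    Weights and kernels may both differ, since for a pair of draws both change at once. *)
Lemma eq_mixture (w1 w2 : Om -> R) (k1 k2 : Om -> {measure set T -> \bar R})
    (g : T -> \bar R) :
  (forall o, (0 <= w1 o)%R) -> (forall o, (0 <= w2 o)%R) ->
  measurable_fun [set: Om] w1 -> measurable_fun [set: Om] w2 ->
  (forall U, measurable U -> measurable_fun [set: Om] (k1 ^~ U)) ->
  (forall U, measurable U -> measurable_fun [set: Om] (k2 ^~ U)) ->
  (forall U, measurable U ->
    \int[mu]_o ((w1 o)%:E * k1 o U) = \int[mu]_o ((w2 o)%:E * k2 o U)) ->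
  measurable_fun [set: T] g -> (forall y, 0 <= g y) ->
  mixture w1 k1 g = mixture w2 k2 g.
Proof.
move=> w10 w20 mw1 mw2 mk1 mk2 k12 mg g0.
rewrite (mixture_cvg w1 k1 w10 mw1 mk1 g mg g0).
rewrite (mixture_cvg w2 k2 w20 mw2 mk2 g mg g0).
apply: congr_lim; apply/funext => n.
set f := nnsfun_approx _ _ _.
have -> := mixture_nnsfun w1 k1 w10 mw1 mk1 f.
have -> := mixture_nnsfun w2 k2 w20 mw2 mk2 f.
by apply: eq_bigr => i _; rewrite k12.
Qed.

End mixture.

(** * Mean of conditionally i.i.d. draws *)

Lemma measurable_norm_gt {R : realType} d (T : measurableType d) (f : T -> R)
    (r : R) :
  measurable_fun [set: T] f -> measurable [set x | r < `|f x|].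
Proof.
move=> mf; have mlt : measurable_fun [set: T] (fun x => r < `|f x|).
  by apply: measurable_fun_ltr => //; exact: measurableT_comp.
by have := mlt measurableT [set true] I; rewrite setTI.
Qed.

Section conditional_draws.
Local Open Scope ereal_scope.
Context {R : realType} {d d1 d2 : measure_display} {Om : measurableType d}
  {T1 : measurableType d1} {T2 : measurableType d2} (P : probability Om R)
  (V : Om -> T1) (K : T1 -> pprobability T2 R) (N : nat)
  (Z : Om -> N.-tuple T2) (g : T2 -> R) (c : R).
Hypothesis mV : measurable_fun [set: Om] V.
Hypothesis mK : measurable_fun [set: T1] K.
Hypothesis mZ : measurable_fun [set: Om] Z.
Hypothesis ZK : iid_draws_given P V K Z.
Hypothesis mg : measurable_fun [set: T2] g.
Hypothesis g0 : forall y, (0 <= g y)%R.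
Hypothesis gc : forall y, (g y <= c)%R.

(** [k] is the conditional law of a draw. The Dirac kernels [kZ j] and [kV] turn evaluation at a
    draw or at [V] into integration against a kernel, as [eq_mixture] requires. *)
Let k o : {measure set T2 -> \bar R} := kprobability mK (V o).
Let kZ j o : {measure set T2 -> \bar R} := \d_(tnth (Z o) j).
Let kV o : {measure set T1 -> \bar R} := \d_(V o).
Let G v := (\int[K v]_y g y)%R.
Let gZ j o := g (tnth (Z o) j).

Let mk U : measurable U -> measurable_fun [set: Om] (k ^~ U).
Proof.
move=> mU.
exact: (measurableT_comp (measurable_kernel (kprobability mK) U mU)).
Qed.

Let mZj j : measurable_fun [set: Om] (fun o => tnth (Z o) j).
Proof. exact: (measurableT_comp (measurable_tnth j)). Qed.

Let mkZ j U : measurable U -> measurable_fun [set: Om] (kZ j ^~ U).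
Proof.
move=> mU; apply: (measurableT_comp (f := fun x => \d_x U : \bar R)) => //.
exact: measurable_fun_dirac.
Qed.

Let mkV U : measurable U -> measurable_fun [set: Om] (kV ^~ U).
Proof.
move=> mU; apply: (measurableT_comp (f := fun x => \d_x U : \bar R)) => //.
exact: measurable_fun_dirac.
Qed.

Let kZE j o B : kZ j o B = (\1_B (tnth (Z o) j))%:E.
Proof. by []. Qed.

Let mgE : measurable_fun [set: T2] (EFin \o g).
Proof. exact/measurable_EFinP. Qed.

Let mgZ j : measurable_fun [set: Om] (gZ j).
Proof. exact: (measurableT_comp mg). Qed.

Lemma integral_cond_ge0_le v : 0 <= \int[K v]_y (g y)%:E <= c%:E.
Proof.
apply/andP; split; first by apply: integral_ge0 => y _; rewrite lee_fin.
apply: (@le_trans _ _ (\int[K v]_y c%:E)).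
  apply: ge0_le_integral => //.
  - by move=> y _; rewrite lee_fin.
  - by move=> y _; rewrite lee_fin.
by rewrite integral_cst//= probability_setT mule1.
Qed.

Lemma EFin_cond_mean v : (G v)%:E = \int[K v]_y (g y)%:E.
Proof.
have /andP[I0 Ic] := integral_cond_ge0_le v.
by rewrite /G /Rintegral fineK// ge0_fin_numE// (le_lt_trans Ic)// ltry.
Qed.

Lemma cond_mean_ge0 v : (0 <= G v)%R.
Proof. by have /andP[] := integral_cond_ge0_le v; rewrite -EFin_cond_mean. Qed.

Lemma cond_mean_le v : (G v <= c)%R.
Proof. by have /andP[] := integral_cond_ge0_le v; rewrite -EFin_cond_mean. Qed.

Lemma measurable_cond_mean : measurable_fun [set: T1] G.
Proof.
have h := @measurable_fun_integral_kernel _ _ _ _ _ (kprobability mK)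
  (measurable_kernel (kprobability mK)) (EFin \o g) (fun y => g0 y) mgE.
apply/measurable_EFinP; move: h.
by congr (measurable_fun _ _); apply/funext => v; rewrite /= EFin_cond_mean.
Qed.

Let mGV : measurable_fun [set: Om] (G \o V).
Proof. exact: (measurableT_comp measurable_cond_mean). Qed.

(** The case of the draw hypothesis in which every event but the [j]-th is the whole space. *)
Let draw1 j A B : measurable A -> measurable B ->
  \int[P]_o ((\1_A (V o))%:E * kZ j o B) = \int[P]_o ((\1_A (V o))%:E * k o B).
Proof.
move=> mA mB.
have := ZK A (fun i => if i == j then B else setT) mA.
have mBi (i : 'I_N) : measurable (if i == j then B else setT) by case: ifP.
move=> /(_ mBi).
have -> : [set o | forall i, (if i == j then B else setT) (tnth (Z o) i)] =
    (fun o => tnth (Z o) j) @^-1` B.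
  apply/seteqP; split => o /=; first by move=> /(_ j); rewrite eqxx.
  by move=> Bo i; case: eqP => // ->.
have mVA : measurable (V @^-1` A).
  by rewrite -[X in measurable X]setTI; exact: mV.
have mZB : measurable ((fun o => tnth (Z o) j) @^-1` B).
  by rewrite -[X in measurable X]setTI; exact: mZj.
move=> e; transitivity (P (V @^-1` A `&` (fun o => tnth (Z o) j) @^-1` B)).
  rewrite -[X in _ = P X]setIT -integral_indic//; last exact: measurableI.
  by apply: eq_integral => o _; rewrite kZE indicI -EFinM.
rewrite e integral_mkcond; apply: eq_integral => o _.
have VA : (o \in V @^-1` A) = (V o \in A) by apply/idP/idP; rewrite !inE.
rewrite patchE indicE VA; case: ifP => _; last by rewrite mul0e.
rewrite mul1e (bigD1 j)//= eqxx big1 ?mule1// => i /negPf ->.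
by rewrite probability_setT.
Qed.

(** Two events are kept this time, hence a product of two conditional probabilities; [fine] makes
    the first one a real weight. *)
Let draw2 j l A B : j != l -> measurable A -> measurable B ->
  \int[P]_o ((\1_A (tnth (Z o) j))%:E * kZ l o B) =
  \int[P]_o ((fine (k o A))%:E * k o B).
Proof.
move=> jl mA mB.
have := ZK setT (fun i => if i == j then A else if i == l then B else setT)
  measurableT.
have mBi (i : 'I_N) :
    measurable (if i == j then A else if i == l then B else setT).
  by case: ifP => //; case: ifP.
move=> /(_ mBi); rewrite preimage_setT setTI.
have -> : [set o | forall i, (if i == j then A else if i == l then B else setT)
      (tnth (Z o) i)] =
    (fun o => tnth (Z o) j) @^-1` A `&` (fun o => tnth (Z o) l) @^-1` B.
  apply/seteqP; split => o /=.
    move=> h; have := h j; rewrite eqxx; have := h l.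
    by rewrite eq_sym (negPf jl) eqxx.
  by move=> [Ao Bo] i; case: eqP => [->//|_]; case: eqP => // ->.
have mZA : measurable ((fun o => tnth (Z o) j) @^-1` A).
  by rewrite -[X in measurable X]setTI; exact: mZj.
have mZB : measurable ((fun o => tnth (Z o) l) @^-1` B).
  by rewrite -[X in measurable X]setTI; exact: mZj.
move=> e; transitivity (P ((fun o => tnth (Z o) j) @^-1` A `&`
   (fun o => tnth (Z o) l) @^-1` B)); last first.
  rewrite e; apply: eq_integral => o _.
  have lj : l != j by rewrite eq_sym.
  rewrite (bigD1 j)//= eqxx (bigD1 l)//= (negPf lj) eqxx.
  rewrite big1 ?mule1; last first.
    by move=> i /andP[/negPf -> /negPf ->]; rewrite probability_setT.
  by rewrite fineK// fin_num_measure.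
rewrite -[X in _ = P X]setIT -integral_indic//; last exact: measurableI.
by apply: eq_integral => o _; rewrite kZE indicI -EFinM.
Qed.

Let integral_kZ j o f : measurable_fun [set: T2] f ->
  \int[kZ j o]_y f y = f (tnth (Z o) j).
Proof. by move=> mf; rewrite integral_dirac// diracT mul1e. Qed.

Let integral_k o : \int[k o]_y (g y)%:E = (G (V o))%:E.
Proof. by rewrite EFin_cond_mean. Qed.

(** Conditioning on [V] replaces [g] at a draw by [G (V)]. The first pass of [eq_mixture] goes from
    events of the draw to [g], with an event of [V] as weight; the second goes from events of [V] to
    [G]. *)
Lemma moment_draw_mean j :
  \int[P]_o (gZ j o * G (V o))%:E = \int[P]_o (G (V o) ^+ 2)%:E.
Proof.
have step1 A : measurable A ->
    \int[P]_o ((\1_A (V o))%:E * (gZ j o)%:E) =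
    \int[P]_o ((\1_A (V o))%:E * (G (V o))%:E).
  move=> mA.
  have mw : measurable_fun [set: Om] (fun o => \1_A (V o) : R).
    by apply: (measurableT_comp (f := \1_A : T1 -> R)).
  have := @eq_mixture _ _ _ _ _ P _ _ (kZ j) k (EFin \o g) _ _ mw mw
    (mkZ j) mk _ mgE _.
  rewrite /mixture => h.
  under eq_integral do rewrite -[X in _ * X](integral_kZ j _ _ mgE).
  under [RHS]eq_integral do rewrite -[X in _ * X]integral_k.
  by apply: h => // B mB; exact: draw1.
have := @eq_mixture _ _ _ _ _ P (gZ j) (G \o V) kV kV (EFin \o G) _ _
  (mgZ j) mGV mkV mkV _ _ _.
rewrite /mixture => h.
transitivity (\int[P]_o ((gZ j o)%:E * \int[kV o]_y (G y)%:E)).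
  apply: eq_integral => o _; rewrite integral_dirac//.
    by rewrite diracT mul1e EFinM.
  by apply/measurable_EFinP; exact: measurable_cond_mean.
rewrite h//.
- apply: eq_integral => o _; rewrite integral_dirac//.
    by rewrite diracT mul1e -EFinM expr2.
  by apply/measurable_EFinP; exact: measurable_cond_mean.
- by move=> o; exact: g0.
- by move=> o; exact: cond_mean_ge0.
- move=> A mA; have := step1 A mA.
  under eq_integral do rewrite muleC.
  by under [RHS]eq_integral do rewrite muleC.
- by apply/measurable_EFinP; exact: measurable_cond_mean.
- by move=> v /=; rewrite lee_fin cond_mean_ge0.
Qed.

(** Given [V], distinct draws are independent with the same mean. The first pass treats draw [l]
    with an event of draw [j] as weight; in the second, [g] at draw [l] is the weight and the event
    of draw [j] becomes the integrand. *)
Lemma moment_draw_pair j l : j != l ->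
  \int[P]_o (gZ j o * gZ l o)%:E = \int[P]_o (G (V o) ^+ 2)%:E.
Proof.
move=> jl.
have step1 A : measurable A ->
    \int[P]_o ((\1_A (tnth (Z o) j))%:E * (gZ l o)%:E) =
    \int[P]_o ((fine (k o A))%:E * (G (V o))%:E).
  move=> mA.
  have mw : measurable_fun [set: Om] (fun o => \1_A (tnth (Z o) j) : R).
    by apply: (measurableT_comp (f := \1_A : T2 -> R)).
  have mw2 : measurable_fun [set: Om] (fun o => fine (k o A)).
    apply: (measurableT_comp (f := @fine R)) => //; exact: mk.
  have := @eq_mixture _ _ _ _ _ P _ _ (kZ l) k (EFin \o g) _ _ mw mw2
    (mkZ l) mk _ mgE _.
  rewrite /mixture => h.
  under eq_integral do rewrite -[X in _ * X](integral_kZ l _ _ mgE).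
  under [RHS]eq_integral do rewrite -[X in _ * X]integral_k.
  by apply: h => // B mB; exact: draw2.
have := @eq_mixture _ _ _ _ _ P (gZ l) (G \o V) (kZ j) k (EFin \o g) _ _
  (mgZ l) mGV (mkZ j) mk _ mgE _.
rewrite /mixture => h.
transitivity (\int[P]_o ((gZ l o)%:E * \int[kZ j o]_y (g y)%:E)).
  by apply: eq_integral => o _; rewrite (integral_kZ j _ _ mgE) -EFinM mulrC.
rewrite h//.
- by apply: eq_integral => o _; rewrite integral_k -EFinM expr2.
- by move=> o; exact: g0.
- by move=> o; exact: cond_mean_ge0.
- move=> A mA; have := step1 A mA; rewrite /kZ.
  under eq_integral do rewrite muleC.
  move=> ->; apply: eq_integral => o _.
  rewrite muleC; congr (_ * _); rewrite fineK//.
  exact: (fin_num_measure (K (V o))).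
Qed.

Let sumZ o := (\sum_(j < N) gZ j o)%R.

Let msumZ : measurable_fun [set: Om] sumZ.
Proof. by apply: measurable_sum => j; exact: mgZ. Qed.

Let sumZ0 o : (0 <= sumZ o)%R.
Proof. by apply: sumr_ge0 => j _; exact: g0. Qed.

(* The cross terms of [(sumZ - N G)^2] are moved to the other side, so that
   only nonnegative functions are integrated. *)
Let square_split o :
  ((sumZ o - N%:R * G (V o)) ^+ 2 + N%:R *+ 2 * (G (V o) * sumZ o) =
   sumZ o ^+ 2 + N%:R ^+ 2 * G (V o) ^+ 2)%R.
Proof. by rewrite sqrrB exprMn mulr2n; ring. Qed.

(** In the expanded square each of the [N] diagonal terms has mean at most [c ^+ 2], since
    [0 <= g <= c]. Pairs, cross term and squared mean all reduce to multiples of [b], the mean of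
    [G(V)^2], and these cancel. *)
Lemma second_moment_sum_draws :
  \int[P]_o ((sumZ o - N%:R * G (V o)) ^+ 2)%:E <= (N%:R * c ^+ 2)%:E.
Proof.
set b := \int[P]_o (G (V o) ^+ 2)%:E.
have Gc2 o : (G (V o) ^+ 2 <= c ^+ 2)%R.
  by rewrite lerXn2r ?nnegrE ?cond_mean_ge0 ?cond_mean_le//
     (le_trans (cond_mean_ge0 _) (cond_mean_le (V o))).
have integral_le_cst (f : Om -> R) : (forall o, 0 <= f o)%R ->
    measurable_fun [set: Om] f -> (forall o, f o <= c ^+ 2)%R ->
    \int[P]_o (f o)%:E <= (c ^+ 2)%:E.
  move=> f0 mf fc; apply: (@le_trans _ _ (\int[P]_o (c ^+ 2)%:E)).
    apply: ge0_le_integral => //=.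
    - by move=> o _; rewrite lee_fin.
    - exact/measurable_EFinP.
    - by move=> o _; rewrite lee_fin.
  by rewrite integral_cst//= probability_setT mule1.
have b0 : 0 <= b by apply: integral_ge0 => o _; rewrite lee_fin sqr_ge0.
have mG2 : measurable_fun [set: Om] (fun o => G (V o) ^+ 2)%R.
  exact: measurable_funX.
have bc : b <= (c ^+ 2)%:E.
  by apply: integral_le_cst => // o; exact: sqr_ge0.
(* Finiteness of [b] is what permits the cancellation at the end. *)
have [b' be] : exists b', b = b'%:E.
  by exists (fine b); rewrite fineK// ge0_fin_numE// (le_lt_trans bc)// ltry.
have EGS : \int[P]_o (G (V o) * sumZ o)%:E = (N%:R * b')%:E.
  transitivity (\int[P]_o \sum_(j < N) (gZ j o * G (V o))%:E).
    by apply: eq_integral => o _; rewrite sumEFin mulrC mulr_suml.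
  rewrite ge0_integral_sum//=.
  - under eq_bigr do rewrite moment_draw_mean -/b be.
    by rewrite sumEFin sumr_const card_ord mulr_natl.
  - by move=> j; apply/measurable_EFinP; exact: measurable_funM.
  - by move=> j o _; rewrite lee_fin mulr_ge0 ?cond_mean_ge0 ?g0.
have ESS : \int[P]_o (sumZ o ^+ 2)%:E <= (N%:R * c ^+ 2 + N%:R ^+ 2 * b')%:E.
  have pair0 j l o : (0 <= gZ j o * gZ l o)%R by rewrite mulr_ge0 ?g0.
  have mpair j l : measurable_fun [set: Om] (fun o => gZ j o * gZ l o)%R.
    exact: measurable_funM.
  have -> : \int[P]_o (sumZ o ^+ 2)%:E =
      \sum_(j < N) \sum_(l < N) \int[P]_o (gZ j o * gZ l o)%:E.
    transitivity (\int[P]_o \sum_(j < N) \sum_(l < N) (gZ j o * gZ l o)%:E).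
      apply: eq_integral => o _; rewrite expr2 mulr_suml -sumEFin.
      by apply: eq_bigr => j _; rewrite mulr_sumr -sumEFin.
    rewrite ge0_integral_sum//=.
    - apply: eq_bigr => j _; rewrite ge0_integral_sum//.
        by move=> l; exact/measurable_EFinP.
      by move=> l o _; rewrite lee_fin.
    - by move=> j; apply: emeasurable_sum => l; exact/measurable_EFinP.
    - by move=> j o _; apply: sume_ge0 => l _; rewrite lee_fin.
  apply: (@le_trans _ _ (\sum_(j < N) (c ^+ 2 + N%:R * b')%:E)).
    apply: lee_sum => j _; rewrite (bigD1 j)//= EFinD leeD//.
      apply: integral_le_cst => // o.
      rewrite -expr2 lerXn2r ?nnegrE ?g0 ?gc//.
      exact: le_trans (g0 _) (gc (tnth (Z o) j)).
    rewrite (eq_bigr (fun=> b'%:E)); last first.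
      by move=> l lj; rewrite moment_draw_pair 1?eq_sym// -/b be.
    (* The [N - 1] indices other than [j] are counted as [N], which gives exactly the multiple of
       [b'] that cancels later. *)
    rewrite sumEFin lee_fin sumr_const -[X in (X <= _)%R]mulr_natl ler_wpM2r//.
      by rewrite -lee_fin -be.
    by rewrite ler_nat (leq_trans (max_card _))// card_ord.
  rewrite sumEFin lee_fin sumr_const card_ord -[X in (X <= _)%R]mulr_natl.
  by rewrite le_eqVlt; apply/orP; left; apply/eqP; ring.
have [I0 IS] : 0 <= \int[P]_o ((sumZ o - N%:R * G (V o)) ^+ 2)%:E /\
  \int[P]_o ((sumZ o - N%:R * G (V o)) ^+ 2)%:E +
    (N%:R *+ 2 * (N%:R * b'))%:E =
  \int[P]_o (sumZ o ^+ 2)%:E + (N%:R ^+ 2 * b')%:E.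
  split; first by apply: integral_ge0 => o _; rewrite lee_fin sqr_ge0.
  have mD : measurable_fun [set: Om]
      (fun o => (sumZ o - N%:R * G (V o)) ^+ 2)%R.
    apply: measurable_funX; apply: measurable_funB => //.
    exact: measurable_funM.
  have -> : (N%:R *+ 2 * (N%:R * b'))%:E =
      \int[P]_o ((N%:R *+ 2)%:E * (G (V o) * sumZ o)%:E).
    rewrite ge0_integralZl_EFin ?EGS//.
    - by move=> o _; rewrite lee_fin mulr_ge0 ?cond_mean_ge0.
    - by apply/measurable_EFinP; exact: measurable_funM.
  have -> : (N%:R ^+ 2 * b')%:E =
      \int[P]_o ((N%:R ^+ 2)%:E * (G (V o) ^+ 2)%:E).
    rewrite ge0_integralZl_EFin -/b ?be//.
    - by move=> o _; rewrite lee_fin sqr_ge0.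
    - by apply/measurable_EFinP.
  rewrite -!ge0_integralD//.
  - by apply: eq_integral => o _; rewrite -!EFinM -!EFinD square_split.
  - by move=> o _; rewrite lee_fin sqr_ge0.
  - by apply/measurable_EFinP; exact: measurable_funX.
  - by move=> o _; rewrite -EFinM lee_fin mulr_ge0 ?sqr_ge0.
  - by apply: measurable_funeM; exact/measurable_EFinP.
  - by move=> o _; rewrite lee_fin sqr_ge0.
  - exact/measurable_EFinP.
  - by move=> o _; rewrite -EFinM lee_fin !mulr_ge0 ?cond_mean_ge0.
  - by apply: measurable_funeM; apply/measurable_EFinP; exact: measurable_funM.
have : \int[P]_o ((sumZ o - N%:R * G (V o)) ^+ 2)%:E +
      (N%:R *+ 2 * (N%:R * b'))%:E <=
    (N%:R * c ^+ 2)%:E + (N%:R *+ 2 * (N%:R * b'))%:E.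
  rewrite IS; apply: (le_trans (leeD2r _ ESS)).
  rewrite -!EFinD lee_fin -addrA lerD2l.
  by rewrite le_eqVlt; apply/orP; left; apply/eqP; ring.
by rewrite leeD2rE.
Qed.

(** Chebyshev's inequality for the sum: multiplying the deviation by [N] turns the threshold into
    [N t] and the bound into [N c^2 / (N t)^2]. *)
Lemma deviation_draws t : (0 < N)%N -> (0 < t)%R ->
  P [set o | t < `|N%:R^-1 * (\sum_(j < N) g (tnth (Z o) j)) -
      \int[K (V o)]_y g y|]%R
  <= (c ^+ 2 / (N%:R * t ^+ 2))%:E.
Proof.
move=> N0 t0.
have N0R : (0 < N%:R :> R)%R by rewrite ltr0n.
set A := (X in P X).
have mdev : measurable_fun [set: Om] (fun o => sumZ o - N%:R * G (V o))%R.
  by apply: measurable_funB => //; exact: measurable_funM.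
have normE o : (N%:R * `|N%:R^-1 * sumZ o - G (V o)| =
    `|sumZ o - N%:R * G (V o)|)%R.
  by rewrite -[X in (X * _)%R](gtr0_norm N0R) -normrM mulrBr mulVKf ?gt_eqF.
have AE : A = [set o | (N%:R * t < `|sumZ o - N%:R * G (V o)|)%R].
  apply/seteqP; split => o /=; first by rewrite -normE ltr_pM2l.
  by rewrite -normE ltr_pM2l.
have mA : measurable A.
  by rewrite AE; exact: measurable_norm_gt.
have : ((N%:R * t) ^+ 2)%:E * P A <= (N%:R * c ^+ 2)%:E.
  apply: le_trans second_moment_sum_draws.
  rewrite -[X in _ * P X]setIT -integral_indic// -ge0_integralZl_EFin//.
  - apply: ge0_le_integral => //.
    + by move=> o _; rewrite -EFinM lee_fin mulr_ge0 ?sqr_ge0.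
    + apply: measurable_funeM; apply/measurable_EFinP; exact: measurable_indic.
    + by apply/measurable_EFinP; exact: measurable_funX.
    + move=> o _; rewrite -EFinM lee_fin indicE; case: (boolP (o \in A)) => Ao.
        have Nt0 : (0 <= N%:R * t)%R by rewrite mulr_ge0// ltW.
        rewrite mulr1 -[leRHS]real_normK ?num_real// lerXn2r ?nnegrE//.
        by move: Ao; rewrite inE AE => /ltW.
      by rewrite mulr0 sqr_ge0.
  - by apply/measurable_EFinP; exact: measurable_indic.
  - exact: sqr_ge0.
rewrite muleC -lee_pdivlMr ?exprn_gt0 ?mulr_gt0//; rewrite -EFinM.
move=> /le_trans; apply.
rewrite lee_fin le_eqVlt; apply/orP; left; apply/eqP.
by field; rewrite !gt_eqF.
Qed.

End conditional_draws.

(** * Samples as conditional draws, and single-draw marginals *)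

(** The conditioning variable has a single value, so an event [A] of it either always happens or
    never does. *)
Lemma iid_draws_of_sample {R : realType} {d d' : measure_display}
    (Om : measurableType d) (P : probability Om R) (T : measurableType d')
    (Q : probability T R) N (Z : Om -> N.-tuple T) :
  iid_sample P Q Z ->
  iid_draws_given P (fun _ : Om => tt) (cst (Q : pprobability T R)) Z.
Proof.
move=> ZQ A B mA mB; have [Att|nAtt] := pselect (A tt).
  have -> : (fun _ : Om => tt) @^-1` A = setT by apply/seteqP; split.
  rewrite setTI ZQ//.
  rewrite [RHS](_ : _ = (\prod_(i < N) Q (B i)) * P setT)%E.
    by rewrite probability_setT mule1.
  exact: integral_cst.
have -> : (fun _ : Om => tt) @^-1` A = set0 by apply/seteqP; split.
by rewrite set0I measure0 integral_set0.
Qed.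

Lemma prob_draw {R : realType} {d d1 d2 : measure_display}
    (Om : measurableType d) (P : probability Om R)
    (T1 : measurableType d1) (T2 : measurableType d2) (V : Om -> T1)
    (K : T1 -> pprobability T2 R) N (Z : Om -> N.-tuple T2) (j : 'I_N)
    (B : set T2) : iid_draws_given P V K Z -> measurable B ->
  P [set o | B (tnth (Z o) j)] = (\int[P]_o K (V o) B)%E.
Proof.
move=> ZK mB.
have mBi (i : 'I_N) : measurable (if i == j then B else setT) by case: ifP.
have := ZK setT (fun i => if i == j then B else setT) measurableT mBi.
rewrite preimage_setT setTI.
have -> : [set o | forall i, (if i == j then B else setT) (tnth (Z o) i)] =
    [set o | B (tnth (Z o) j)].
  apply/seteqP; split => o /=; first by move=> /(_ j); rewrite eqxx.
  by move=> Bo i; case: eqP => // ->.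
move=> ->; apply: eq_integral => o _.
rewrite (bigD1 j)//= eqxx big1 ?mule1// => i /negPf ->.
by rewrite probability_setT.
Qed.

(** [Q] is a bare set function, as [centered_gaussian] is, so its total mass is a hypothesis; it
    makes the other factors equal to 1. *)
Lemma iid_sample_marginal {R : realType} {d d' : measure_display}
    (Om : measurableType d) (P : probability Om R) (T : measurableType d')
    (Q : set T -> \bar R) N (Z : Om -> N.-tuple T) (j : 'I_N) (B : set T) :
  Q setT = 1%E -> iid_sample P Q Z -> measurable B ->
  P [set o | B (tnth (Z o) j)] = Q B.
Proof.
move=> QT ZQ mB.
have mBi (i : 'I_N) : measurable (if i == j then B else setT) by case: ifP.
have := ZQ (fun i => if i == j then B else setT) mBi.
have -> : [set o | forall i, (if i == j then B else setT) (tnth (Z o) i)] =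
    [set o | B (tnth (Z o) j)].
  apply/seteqP; split => o /=; first by move=> /(_ j); rewrite eqxx.
  by move=> Bo i; case: eqP => // ->.
by move=> ->; rewrite (bigD1 j)//= eqxx big1 ?mule1// => i /negPf ->.
Qed.

(** * Norms and tails *)

Lemma norm2_sqr {R : realType} (I : finType) (v : I -> R) :
  norm2 v ^+ 2 = \sum_i v i ^+ 2.
Proof. by rewrite sqr_sqrtr// sumr_ge0// => i _; exact: sqr_ge0. Qed.

Lemma norm2_ge0 {R : realType} (I : finType) (v : I -> R) : 0 <= norm2 v.
Proof. exact: sqrtr_ge0. Qed.

Lemma le_coord_norm2 {R : realType} (I : finType) (v : I -> R) i :
  `|v i| <= norm2 v.
Proof.
rewrite -ler_sqr ?nnegrE ?norm2_ge0// norm2_sqr real_normK ?num_real//.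
by rewrite (bigD1 i)//= lerDl sumr_ge0// => j _; exact: sqr_ge0.
Qed.

Lemma normoo_le {R : realType} (I : finType) (v : I -> R) r :
  0 <= r -> (forall i, `|v i| <= r) -> normoo v <= r.
Proof. by move=> r0 vr; apply: bigmax_le. Qed.

Lemma normoo_ge0 {R : realType} (I : finType) (v : I -> R) : 0 <= normoo v.
Proof. exact: bigmax_ge_id. Qed.

Lemma normoo_le_norm2 {R : realType} (I : finType) (v : I -> R) :
  normoo v <= norm2 v.
Proof.
by apply: normoo_le; [exact: norm2_ge0|move=> i; exact: le_coord_norm2].
Qed.

Lemma measurable_normoo {R : realType} d (T : measurableType d) (I : finType)
    (v : T -> I -> R) :
  (forall i, measurable_fun [set: T] (v ^~ i)) ->
  measurable_fun [set: T] (fun x => normoo (v x)).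
Proof.
move=> mv; rewrite /normoo; elim: (index_enum I) => [|i s ih].
  by under eq_fun do rewrite big_nil; exact: measurable_cst.
under eq_fun do rewrite big_cons.
by apply: measurable_maxr => //; exact: measurableT_comp.
Qed.

(** A union bound over the coordinates. *)
Lemma prob_normoo_gt {R : realType} d (Om : measurableType d)
    (P : probability Om R) (I : finType) (v : Om -> I -> R) (r a : R) :
  0 <= r -> (forall i, measurable_fun [set: Om] (v ^~ i)) ->
  (forall i, P [set o | (r < `|v o i|)%R] <= a%:E)%E ->
  (P [set o | (r < normoo (v o))%R] <= (#|I|%:R * a)%:E)%E.
Proof.
move=> r0 mv va.
have mA i : measurable [set o | r < `|v o i|] by exact: measurable_norm_gt.
(* The union runs along a list, so that measurability and the bound come from one induction. *)
have bound (s : seq I) :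
    measurable [set o | exists2 i, i \in s & r < `|v o i|] /\
    (P [set o | exists2 i, i \in s & (r < `|v o i|)%R] <=
     ((size s)%:R * a)%:E)%E.
  elim: s => [|i s [ms ih]].
    have -> : [set o | exists2 i, i \in [::] & r < `|v o i|] = set0.
      by apply/seteqP; split => o //= -[].
    by rewrite measure0 mul0r.
  have -> : [set o | exists2 j, j \in i :: s & r < `|v o j|] =
      [set o | r < `|v o i|] `|` [set o | exists2 j, j \in s & r < `|v o j|].
    apply/seteqP; split => o /=.
      move=> [j]; rewrite inE => /predU1P[->|js] rj; first by left.
      by right; exists j.
    by move=> [ri|[j js rj]]; [exists i|exists j]; rewrite ?inE ?eqxx ?js ?orbT.
  split; first exact: measurableU.
  rewrite (le_trans (measureU2 _ _ _))//= -addn1 natrD mulrDl mul1r addrC EFinD.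
  by rewrite leeD.
have [mU Ub] := bound (enum I); rewrite cardE; apply: le_trans Ub.
rewrite le_measure// ?inE//.
  rewrite (_ : [set o | _] = [set o | r < `|normoo (v o)|]).
    by apply: measurable_norm_gt; exact: measurable_normoo.
  by apply/seteqP; split => o /=; rewrite ger0_norm ?normoo_ge0.
(* If no coordinate exceeded [r], neither would the maximum; [0 <= r] accounts for its initial value
   0. *)
move=> o /= rv; apply/not_exists2P => h.
move: rv; rewrite ltNge => /negP; apply; apply: normoo_le => // i.
by have [|/negP] := h i; rewrite ?mem_enum// -leNgt.
Qed.

(** The events [n.+1 < |f|] decrease to the empty set, so their probabilities tend to 0 by
    continuity from above. *)
Lemma tight_prob {R : realType} d (T : measurableType d)
    (Q : probability T R) (f : T -> R) (a : R) :
  measurable_fun [set: T] f -> 0 < a ->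
  exists2 t : R, 0 < t & (Q [set x | (t < `|f x|)%R] <= a%:E)%E.
Proof.
move=> mf a0; pose F n := [set x | n.+1%:R < `|f x|].
have mF n : measurable (F n) by exact: measurable_norm_gt.
have F0 : \bigcap_n F n = set0.
  apply/seteqP; split => // x /= Fx.
  have := Fx (Num.trunc `|f x|) I; rewrite /F/= ltNge => /negP; apply.
  by rewrite ltW// truncnS_gt.
have : Q \o F @ \oo --> Q (\bigcap_n F n).
  apply: nonincreasing_cvg_mu => //.
  - by rewrite (le_lt_trans (probability_le1 _ _))// ltry.
  - by rewrite F0.
  - move=> m n mn; apply/subsetPset => x; rewrite /F /=.
    by apply: le_lt_trans; rewrite ler_nat.
rewrite F0 measure0 => /fine_cvgP[_] /cvgrPdist_le /(_ _ a0).
move=> [n _ /(_ n (leqnn n))].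
rewrite /= sub0r normrN => Fa; exists n.+1%:R => //.
have QF : Q (F n) \is a fin_num by exact: fin_num_measure.
by rewrite -(fineK QF) lee_fin; exact: le_trans (ler_norm _) Fa.
Qed.

(** [|s x| > r >= s t] forces [|x| > t], so a threshold for the standard normal law serves every
    noise level, [s = 0] included. *)
Lemma centered_gaussian_tail {R : realType} (s t r : R) :
  0 <= s -> s * t <= r ->
  (centered_gaussian s [set x : R | (r < `|x|)%R] <=
   normal_prob 0 1 [set x : R | (t < `|x|)%R])%E.
Proof.
move=> s0 str; rewrite /centered_gaussian /pushforward; apply: le_measure.
- rewrite inE; apply: measurable_norm_gt.
  exact: mulrl_measurable.
- by rewrite inE; exact: (@measurable_norm_gt _ _ _ id).
- move=> x /=; rewrite normrM (ger0_norm s0) !ltNge; apply: contra => xt.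
  by rewrite (le_trans _ str)// ler_wpM2l.
Qed.

Lemma centered_gaussianT {R : realType} (s : R) :
  centered_gaussian s setT = 1%E.
Proof.
by rewrite /centered_gaussian /pushforward preimage_setT probability_setT.
Qed.

(** * Sensitivity and measurability of the workload *)

(** Only the replaced record survives in the difference, and [(x - y)^2 <= 2 (x^2 + y^2)], summed
    over coordinates, bounds the squared norm by [4 Hq^2 / n^2]. *)
Lemma sensitivity_bound {R : realType} d (T : measurableType d) m
    (h : T -> m.-tuple R) (valid : set T) (Hq : R) n :
  (0 < n)%N -> valid !=set0 ->
  (forall w, valid w -> norm2 (tnth (h w)) <= Hq) ->
  0 <= sensitivity h valid n <= 2 * Hq / n%:R.
Proof.
move=> n0 [w0 vw0] hH; rewrite /sensitivity; set A := [set s | _].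
have Hq0 : 0 <= Hq := le_trans (norm2_ge0 _ _) (hH _ vw0).
have n0R : 0 < n%:R :> R by rewrite ltr0n.
(* A constant dataset compared with itself: the set is nonempty and its supremum nonnegative. *)
have A0 : A 0.
  exists [tuple w0 | _ < n], [tuple w0 | _ < n]; split => //.
  - by move=> i; rewrite tnth_mktuple.
  - by move=> i; rewrite tnth_mktuple.
  - by exists (Ordinal n0).
  - rewrite /norm2 big1 ?sqrtr0// => a _.
    by rewrite tnth_mktuple subrr expr0n.
have ubA : ubound A (2 * Hq / n%:R).
  move=> _ [D [D' [vD vD' [i DD'] ->]]].
  rewrite -ler_sqr ?nnegrE ?norm2_ge0 ?divr_ge0 ?mulr_ge0// norm2_sqr.
  have dE a : tnth (tsub (q_data h D) (q_data h D')) a =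
      (tnth (h (tnth D i)) a - tnth (h (tnth D' i)) a) / n%:R.
    rewrite !tnth_mktuple -mulrBr -sumrB (bigD1 i)//= big1 ?addr0 1?mulrC//.
    by move=> j ji; rewrite DD'// subrr.
  apply: (@le_trans _ _ (\sum_a 2 * (tnth (h (tnth D i)) a ^+ 2 +
      tnth (h (tnth D' i)) a ^+ 2) / n%:R ^+ 2)).
    apply: ler_sum => a _.
    rewrite dE expr_div_n ler_pM2r ?invr_gt0 ?exprn_gt0//.
    rewrite -subr_ge0; set x := tnth _ a; set y := tnth _ a.
    by rewrite (_ : _ - _ = (x + y) ^+ 2) ?sqr_ge0//; ring.
  rewrite -mulr_suml -mulr_sumr big_split/= -!norm2_sqr expr_div_n.
  rewrite ler_pM2r ?invr_gt0 ?exprn_gt0//.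
  have sq w : valid w -> norm2 (tnth (h w)) ^+ 2 <= Hq ^+ 2.
    by move=> vw; rewrite lerXn2r ?nnegrE ?norm2_ge0 ?hH.
  have := sq _ (vD i); have := sq _ (vD' i); rewrite exprMn; lra.
apply/andP; split; first by apply: ub_le_sup A0; exists (2 * Hq / n%:R).
by apply: ge_sup => //; exists 0.
Qed.

Lemma measurable_cat_tuple {d1 d2} (T1 : measurableType d1)
    (T2 : measurableType d2) m n (f : T1 -> m.-tuple T2)
    (g : T1 -> n.-tuple T2) :
  measurable_fun [set: T1] f -> measurable_fun [set: T1] g ->
  measurable_fun [set: T1] (fun x => [tuple of f x ++ g x]).
Proof.
move=> /measurable_fun_tnthP mf /measurable_fun_tnthP mg.
apply/measurable_fun_tnthP => i; case: (split_ordP i) => j ->.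
- rewrite (_ : _ \o _ = (@tnth _ T2) ^~ j \o f)//.
  by apply/funext => x /=; rewrite tnth_lshift.
- rewrite (_ : _ \o _ = (@tnth _ T2) ^~ j \o g)//.
  by apply/funext => x /=; rewrite tnth_rshift.
Qed.

Lemma measurable_workload {R : realType} dX (TX : measurableType dX) p k
    (phi : TX -> p.-tuple R) (extra : record TX R -> k.-tuple R) :
  measurable_fun setT phi -> measurable_fun setT extra ->
  measurable_fun setT (workload phi extra).
Proof.
move=> mphi mextra.
have mphij j : measurable_fun setT (fun w : record TX R => tnth (phi w.1.1) j).
  apply: (measurableT_comp (measurable_tnth j)).
  by apply: (measurableT_comp mphi); apply: measurableT_comp.
have mT t : measurable_fun setT (fun w : record TX R => (w.1.2 == t)%:R : R).
  apply: (measurableT_comp (f := fun b : bool => (b == t)%:R : R)) => //.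
  by apply: measurableT_comp.
have mfeatures t : measurable_fun setT (arm_features phi t).
  apply/measurable_fun_tnthP => j; rewrite (_ : _ \o _ =
      fun w : record TX R => (w.1.2 == t)%:R * tnth (phi w.1.1) j).
    exact: measurable_funM.
  by apply/funext => w /=; rewrite tnth_mktuple.
have moutcomes t : measurable_fun setT (arm_outcomes phi t).
  apply/measurable_fun_tnthP => j; rewrite (_ : _ \o _ =
      fun w : record TX R => (w.1.2 == t)%:R * w.2 * tnth (phi w.1.1) j).
    by do 2 apply: measurable_funM => //.
  by apply/funext => w /=; rewrite tnth_mktuple.
by do 3 apply: measurable_cat_tuple => //.
Qed.

Lemma measurable_valid_record {R : realType} dX (TX : measurableType dX) p
    (phi : TX -> p.-tuple R) (B phimax : R) :
  measurable_fun setT phi -> measurable (valid_record phi B phimax).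
Proof.
move=> mphi; rewrite /valid_record.
have mle (f : record TX R -> R) r : measurable_fun setT f ->
    measurable [set w | f w <= r].
  move=> mf.
  have := measurable_fun_ler mf (@measurable_cst _ _ _ _ setT r).
  by move=> /(_ measurableT [set true] I); rewrite setTI.
apply: measurableI; apply: mle.
  by apply: measurableT_comp.
apply: (measurableT_comp (continuous_measurable_fun (@sqrt_continuous R))).
apply: measurable_sum => j; apply: measurable_funX.
apply: (measurableT_comp (measurable_tnth j)).
by apply: (measurableT_comp mphi); apply: measurableT_comp.
Qed.

(** * Sampling errors of the workload *)

Section truncation.
Context {R : realType} {d : measure_display} {T : measurableType d} {m : nat}
  (valid : set T) (h : T -> m.-tuple R) (H : R).
Hypothesis mvalid : measurable valid.
Hypothesis mh : measurable_fun [set: T] h.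
Hypothesis H0 : 0 <= H.
Hypothesis hH : forall w, valid w -> norm2 (tnth (h w)) <= H.

(* The shift by [H] makes the query nonnegative; it cancels in sampling
   errors. *)
Definition truncated_query (a : 'I_m) (w : T) : R :=
  \1_valid w * tnth (h w) a + H.

Let measurable_truncated_coord a :
  measurable_fun [set: T] (fun w => \1_valid w * tnth (h w) a : R).
Proof.
apply: measurable_funM; first exact: measurable_indic.
exact: (measurableT_comp (measurable_tnth a)).
Qed.

Lemma measurable_truncated_query a :
  measurable_fun [set: T] (truncated_query a).
Proof. by apply: measurable_funD => //; exact: measurable_truncated_coord. Qed.

Let truncated_coord_le a w : `|\1_valid w * tnth (h w) a| <= H.
Proof.
rewrite indicE; case: (boolP (w \in valid)) => vw; last by rewrite mul0r normr0.
rewrite mul1r (le_trans (le_coord_norm2 _ (tnth (h w)) a))// hH//.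
by rewrite inE in vw.
Qed.

Lemma truncated_query_ge0 a w : 0 <= truncated_query a w.
Proof.
have := truncated_coord_le a w; rewrite ler_norml /truncated_query => /andP[].
lra.
Qed.

Lemma truncated_query_le a w : truncated_query a w <= 2 * H.
Proof.
have := truncated_coord_le a w; rewrite ler_norml /truncated_query => /andP[].
lra.
Qed.

(** Truncation does nothing on valid records, and the shift has mean [H] because [0 < n]. *)
Lemma q_data_truncated n (D : n.-tuple T) a : (0 < n)%N ->
  (forall i, valid (tnth D i)) ->
  tnth (q_data h D) a =
  n%:R^-1 * (\sum_(i < n) truncated_query a (tnth D i)) - H.
Proof.
move=> n0 vD; rewrite tnth_mktuple /truncated_query big_split/= mulrDr.
rewrite sumr_const card_ord -[H *+ n]mulr_natl mulKf ?pnatr_eq0 -?lt0n// addrK.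
by congr (_ * _); apply: eq_bigr => i _; rewrite indicE mem_set// mul1r.
Qed.

(** The query agrees almost everywhere with its truncation, whose boundedness gives the
    integrability needed to split off the shift. *)
Lemma q_law_truncated (Q : probability T R) a : {ae Q, forall w, valid w} ->
  tnth (q_law h Q) a = \int[Q]_w truncated_query a w - H.
Proof.
move=> vQ; rewrite tnth_mktuple /truncated_query RintegralD//.
- have -> : \int[Q]__ H = H.
    by rewrite Rintegral_cst// [X in fine X]probability_setT mulr1.
  rewrite addrK /Rintegral; congr fine; apply: ae_eq_integral => //.
  + by apply/measurable_EFinP; exact: (measurableT_comp (measurable_tnth a)).
  + by apply/measurable_EFinP; exact: measurable_truncated_coord.
  + apply: filterS vQ => w vw _.
    by rewrite /= indicE mem_set// mul1r.
- apply: measurable_bounded_integrable => //.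
  + exact: (le_lt_trans (probability_le1 Q measurableT) (ltry 1)).
  + exists H; split; rewrite ?num_real// => x Hx w _.
    exact: le_trans (truncated_coord_le a w) (ltW Hx).
- exact: finite_measure_integrable_cst.
Qed.

End truncation.

Section sampling_error.
Context {R : realType} {d d1 d2 : measure_display} {Om : measurableType d}
  {T1 : measurableType d1} {T2 : measurableType d2} {I : finType}.

Definition sampling_error (g : I -> T2 -> R) (V : Om -> T1)
    (K : T1 -> pprobability T2 R) N (Z : Om -> N.-tuple T2) (o : Om) (i : I) :
    R :=
  N%:R^-1 * (\sum_(j < N) g i (tnth (Z o) j)) - \int[K (V o)]_y g i y.
Arguments sampling_error g V K {N} Z o i.

Variables (g : I -> T2 -> R) (V : Om -> T1) (K : T1 -> pprobability T2 R)
  (N : nat) (Z : Om -> N.-tuple T2) (c : R).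
Hypothesis mV : measurable_fun [set: Om] V.
Hypothesis mK : measurable_fun [set: T1] K.
Hypothesis mZ : measurable_fun [set: Om] Z.
Hypothesis mg : forall i, measurable_fun [set: T2] (g i).
Hypothesis g0 : forall i y, 0 <= g i y.
Hypothesis gc : forall i y, g i y <= c.

Lemma measurable_sampling_error i :
  measurable_fun [set: Om] (fun o => sampling_error g V K Z o i).
Proof.
apply: measurable_funB.
  apply: measurable_funM => //; apply: measurable_sum => j.
  apply: (measurableT_comp (mg i)).
  exact: (measurableT_comp (measurable_tnth j)).
have := measurable_cond_mean K (g i) c mK (mg i) (g0 i) (gc i).
by move=> mG; exact: (measurableT_comp mG mV).
Qed.

(** The threshold [M / sqrt N] cancels the sample size in the deviation bound, which becomes uniform
    in [N]; [#|I|] comes from the union bound. *)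
Lemma prob_sampling_error_gt (P : probability Om R) (M : R) :
  iid_draws_given P V K Z -> (0 < N)%N -> 0 < M ->
  (P [set o | (M / Num.sqrt N%:R < normoo (sampling_error g V K Z o))%R] <=
   (#|I|%:R * (c ^+ 2 / M ^+ 2))%:E)%E.
Proof.
move=> ZK N0 M0; have sN0 : 0 < Num.sqrt N%:R :> R by rewrite sqrtr_gt0 ltr0n.
apply: prob_normoo_gt => [|i|i].
- by rewrite divr_ge0 ?ltW.
- exact: measurable_sampling_error.
- have := deviation_draws P V K N Z (g i) c mV mK mZ ZK (mg i) (g0 i) (gc i)
    (M / Num.sqrt N%:R) N0 (divr_gt0 M0 sN0).
  rewrite expr_div_n sqr_sqrtr// [_%:R * _]mulrC divfK ?pnatr_eq0 -?lt0n//.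
Qed.

End sampling_error.
Arguments sampling_error {R d d1 d2 Om T1 T2 I} g V K {N} Z o i.

(** * Bounds in probability, uniform in the sample sizes *)

Section stochastic_order.
Context {R : realType} {d : measure_display} {Om : measurableType d}
  (P : probability Om R).

(** A non-asymptotic form of [bigOp]: one [M] serves all positive [n] and [N]. Here [W] stands for a
    norm, hence no absolute value. *)
Definition uniform_tail (W : nat -> nat -> Om -> R) (s : nat -> nat -> R) :=
  forall alpha : R, 0 < alpha -> exists2 M : R, 0 < M &
    forall n N, (0 < n)%N -> (0 < N)%N ->
      (P [set o | (M * s n N < W n N o)%R] <= alpha%:E)%E.

(** An inclusion of events; [k] absorbs a constant factor of [E] that is missing from the rate
    [r]. *)
Lemma bigOp_uniform_tail (E W : nat -> nat -> Om -> R) (r s : nat -> nat -> R)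
    (k : R) :
  0 < k ->
  (forall n N, measurable_fun [set: Om] (E n N)) ->
  (forall n N, measurable_fun [set: Om] (W n N)) ->
  (forall n N o M, 0 < M ->
    k * M * r n N < `|E n N o| -> M * s n N < W n N o) ->
  uniform_tail W s -> bigOp P E r.
Proof.
move=> k0 mE mW EW tW alpha /tW[M M0 WM]; exists (k * M); first exact: mulr_gt0.
exists ([set n | (0 < n)%N], [set n | (0 < n)%N]).
  by split; exists 1%N.
move=> [n N] [/= n0 N0]; apply: le_trans (WM n N n0 N0).
apply: le_measure; rewrite ?inE.
- exact: measurable_norm_gt.
- have := measurable_fun_ltr (@measurable_cst _ _ _ _ setT (M * s n N))
    (mW n N).
  by move=> /(_ measurableT [set true] I); rewrite setTI.
- by move=> o /=; exact: EW.
Qed.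

(** [size] selects which of the two indices is the sample size, so that real and synthetic data are
    treated alike. *)
Lemma uniform_tail_sampling_error {d1 d2 : measure_display}
    (T1 : measurableType d1) (T2 : measurableType d2) (I : finType)
    (g : I -> T2 -> R) (c : R) (size : nat -> nat -> nat)
    (V : nat -> nat -> Om -> T1) (K : nat -> nat -> T1 -> pprobability T2 R)
    (Z : forall n N, Om -> (size n N).-tuple T2) :
  (forall n N, (0 < n)%N -> (0 < N)%N -> (0 < size n N)%N) ->
  (forall n N, measurable_fun [set: Om] (V n N)) ->
  (forall n N, measurable_fun [set: T1] (K n N)) ->
  (forall n N, measurable_fun [set: Om] (Z n N)) ->
  (forall i, measurable_fun [set: T2] (g i)) ->
  (forall i y, 0 <= g i y) -> (forall i y, g i y <= c) ->
  (forall n N, (0 < n)%N -> (0 < N)%N ->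
    iid_draws_given P (V n N) (K n N) (Z n N)) ->
  uniform_tail
    (fun n N o => normoo (sampling_error g (V n N) (K n N) (Z n N) o))
    (fun n N => (Num.sqrt (size n N)%:R)^-1).
Proof.
move=> size0 mV mK mZ mg g0 gc ZK alpha alpha0.
(* [M = b + 1] satisfies [b <= M ^+ 2], which brings the bound [#|I| c^2 / M^2] below [alpha]. *)
pose b := #|I|%:R * c ^+ 2 / alpha.
have b0 : 0 <= b by apply: divr_ge0; [rewrite mulr_ge0 ?sqr_ge0|exact: ltW].
exists (b + 1) => [|n N n0 N0]; first by rewrite ltr_wpDl.
have M0 : 0 < b + 1 by rewrite ltr_wpDl.
apply: le_trans (prob_sampling_error_gt g (V n N) (K n N) (size n N) (Z n N) c
  (mV n N) (mK n N) (mZ n N) mg g0 gc P (b + 1) (ZK n N n0 N0)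
  (size0 n N n0 N0) M0) _.
rewrite lee_fin mulrA ler_pdivrMr ?exprn_gt0//.
have -> : #|I|%:R * c ^+ 2 = alpha * b by rewrite /b; field; rewrite gt_eqF.
rewrite ler_pM2l//; nra.
Qed.

End stochastic_order.

(** * Logarithmic factors, validity of the draws, and noise *)

(** The logarithm splits as [ln 1.25 + ln (1 / delta)], and [ln 1.25] is at most a fixed multiple of
    [ln (1 / delta)], which stays above [ln (1 / dmax) > 0]. The factor [ln m] is a positive
    constant. *)
Lemma ln_ratio_bound {R : realType} (m : nat) (dmax : R) : (1 < m)%N ->
  0 < dmax -> dmax < 1 ->
  exists2 C : R, 0 < C & forall delta : R, 0 < delta <= dmax ->
    Num.sqrt (2 * ln (125%:R / 100%:R / delta)) <=
    C * Num.sqrt (ln m%:R * ln (1 / delta)).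
Proof.
move=> m1 dmax0 dmax1.
have lnm : 0 < ln m%:R :> R by rewrite ln_gt0// ltr1n.
have c0 : 1 < 125%:R / 100%:R :> R by lra.
have lnc : 0 < ln (125%:R / 100%:R) :> R by rewrite ln_gt0.
have lndm : 0 < ln (1 / dmax) by rewrite ln_gt0// div1r invf_gt1.
pose C := 2 * (ln (125%:R / 100%:R) / ln (1 / dmax) + 1) / ln m%:R.
have C0 : 0 < C by rewrite divr_gt0// mulr_gt0// addr_gt0// divr_gt0.
exists (Num.sqrt C); first by rewrite sqrtr_gt0.
move=> delta /andP[delta0 delta_dmax].
rewrite -(sqrtrM _ (ltW C0)) ler_wsqrtr//.
have lnd : ln (1 / dmax) <= ln (1 / delta).
  by rewrite ler_ln ?posrE ?divr_gt0// !div1r lef_pV2.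
have -> : ln (125%:R / 100%:R / delta) =
    ln (125%:R / 100%:R) + ln (1 / delta) :> R.
  by rewrite -lnM ?posrE ?divr_gt0// mul1r.
rewrite /C; set x := ln (1 / delta) in lnd *.
set y := ln (1 / dmax) in lndm lnd *.
set z := ln (125%:R / 100%:R) in lnc *.
have -> : 2 * (z / y + 1) / ln m%:R * (ln m%:R * x) = 2 * (z * (x / y) + x).
  by field; rewrite !gt_eqF.
rewrite ler_pM2l// lerD2r ler_peMr//; first exact: ltW.
by rewrite ler_pdivlMr// mul1r.
Qed.

Definition rv_of {R : realType} {d} {Om : measurableType d}
    (P : probability Om R) (f : Om -> R) (mf : measurable_fun [set: Om] f) :
    {RV P >-> R} :=
  HB.pack f (isMeasurableFun.Build _ _ _ _ f mf).

Lemma ae_measure0 {R : realType} {d} {T : measurableType d}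
    (mu : {measure set T -> \bar R}) (A : set T) :
  measurable A -> {ae mu, forall x, A x} -> mu (~` A) = 0%E.
Proof. by move=> mA h; apply/negligibleP => //; exact: measurableC. Qed.

Lemma measure0_ae {R : realType} {d} {T : measurableType d}
    (mu : {measure set T -> \bar R}) (A : set T) :
  measurable A -> mu (~` A) = 0%E -> {ae mu, forall x, A x}.
Proof. by move=> mA h; apply/negligibleP => //; exact: measurableC. Qed.

Lemma ae_forall_sample {R : realType} {d d'} (Om : measurableType d)
    (P : probability Om R) (T : measurableType d') N (Z : Om -> N.-tuple T)
    (A : set T) : measurable_fun [set: Om] Z -> measurable A ->
  (forall j : 'I_N, P [set o | (~` A) (tnth (Z o) j)] = 0%E) ->
  {ae P, forall o, forall j, A (tnth (Z o) j)}.
Proof.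
move=> mZ mA PA; apply: filter_forall => j.
apply: measure0_ae; last exact: PA.
rewrite -[X in measurable X]setTI.
exact: (measurableT_comp (measurable_tnth j) mZ).
Qed.

(** A draw misses [A] with probability the mean of the mass that [K V] gives to the complement, an
    integrand that is zero almost surely; there are finitely many draws. *)
Lemma ae_valid_draws {R : realType} {d d1 d2 : measure_display}
    (Om : measurableType d) (P : probability Om R)
    (T1 : measurableType d1) (T2 : measurableType d2) (V : Om -> T1)
    (K : T1 -> pprobability T2 R) N (Z : Om -> N.-tuple T2) (A : set T2) :
  measurable_fun [set: Om] V -> measurable_fun [set: T1] K ->
  measurable_fun [set: Om] Z -> measurable A -> iid_draws_given P V K Z ->
  {ae P, forall o, {ae K (V o), forall y, A y}} ->
  {ae P, forall o, forall j, A (tnth (Z o) j)}.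
Proof.
move=> mV mK mZ mA ZK KA; apply: ae_forall_sample => // j.
have -> := prob_draw _ _ _ _ _ _ _ _ j _ ZK (measurableC mA).
rewrite (ae_eq_integral (cst 0%E))//.
- by rewrite integral_cst// mul0e.
- have mKA := measurable_kernel (kprobability mK) (~` A) (measurableC mA).
  exact: (measurableT_comp mKA mV).
- by apply: filterS KA => o Ko _; exact: ae_measure0.
Qed.

(** The threshold [t] is chosen once, from the standard normal law; [sigma n <= C * s n] then makes
    [C * t] work for all positive [n]. *)
Lemma gaussian_noise_uniform_tail {R : realType} d (Om : measurableType d)
    (P : probability Om R) m (I : finType) (f : I -> 'I_m)
    (Z : nat -> Om -> m.-tuple R) (sigma s : nat -> R) (C : R) :
  0 < C -> (forall n, measurable_fun [set: Om] (Z n)) ->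
  (forall n, (0 < n)%N -> 0 <= sigma n <= C * s n) ->
  (forall n, (0 < n)%N -> iid_sample P (centered_gaussian (sigma n)) (Z n)) ->
  uniform_tail P (fun n _ o => normoo (fun i => tnth (Z n o) (f i)))
    (fun n _ => s n).
Proof.
move=> C0 mZ sigmas ZG alpha alpha0.
(* The level is shared among the coordinates; the [+ 1] covers an empty index type. *)
have a0 : 0 < alpha / (#|I|%:R + 1) by rewrite divr_gt0// ltr_wpDl.
have [t t0 Ft] := tight_prob _ _ (normal_prob (0 : R) 1) id _
  (@measurable_id _ _ _) a0.
exists (C * t) => [|n N n0 _]; first exact: mulr_gt0.
have /andP[sigma0 sigmaC] := sigmas n n0.
have s0 : 0 <= s n by rewrite -(pmulr_rge0 _ C0) (le_trans sigma0).
apply: (@le_trans _ _ (#|I|%:R * (alpha / (#|I|%:R + 1)))%:E); last first.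
  by rewrite lee_fin mulrCA ger_pMr// ler_pdivrMr ?ltr_wpDl// mul1r lerDl.
apply: prob_normoo_gt => [|i|i].
- by rewrite mulr_ge0// mulr_ge0// ltW.
- exact: (measurableT_comp (measurable_tnth (f i))).
- apply: (le_trans _ Ft).
  have mB : measurable [set x : R | C * t * s n < `|x|].
    exact: (@measurable_norm_gt _ _ _ id).
  have -> := iid_sample_marginal _ _ _ _ _ _ (f i) _ (centered_gaussianT _)
    (ZG n n0) mB.
  by apply: centered_gaussian_tail => //; rewrite mulrAC ler_pM2r.
Qed.

(** * Deterministic decomposition of the error *)

Section error_decomposition.
Context {R : realType} {m : nat}.

Lemma tnth_taddK (u v : m.-tuple R) a : tnth (tsub (tadd u v) u) a = tnth v a.
Proof. by rewrite !tnth_mktuple addrAC subrr add0r. Qed.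

(** A telescoping sum whose moves inside the domain are Lipschitz; in the calibration step the sup
    norm is enlarged to the Euclidean norm of [CalGap]. *)
Lemma estimation_error_le (dom : set (m.-tuple R)) (S : {set 'I_m}) (L : R)
    (est : m.-tuple R -> R) (tau : R)
    (qsyn qPsyn qtilde qD qstar : m.-tuple R) :
  0 <= L -> moment_map_estimator dom S L est ->
  dom qsyn -> dom qPsyn -> dom qtilde -> dom qD -> dom qstar ->
  `|est qsyn - tau| <= L * normoo (Defs.proj S (tsub qD qstar)) +
    L * normoo (Defs.proj S (tsub qtilde qD)) + Approx tau est qstar +
    L * normoo (Defs.proj S (tsub qsyn qPsyn)) + CalGap L S qtilde qPsyn.
Proof.
move=> L0 [_ lip] d1 d2 d3 d4 d5.
have h1 := lip _ _ d4 d5; have h2 := lip _ _ d3 d4; have h3 := lip _ _ d1 d2.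
have h4 : `|est qtilde - est qPsyn| <= CalGap L S qtilde qPsyn.
  by rewrite (le_trans (lip _ _ d3 d2))// ler_wpM2l// normoo_le_norm2.
(* The differences are ordered as the terms of the bound, so that each triangle inequality peels off
   the last one. *)
rewrite (_ : est qsyn - tau = (est qD - est qstar) + (est qtilde - est qD) -
    (tau - est qstar) + (est qsyn - est qPsyn) - (est qtilde - est qPsyn));
  last ring.
rewrite (le_trans (ler_normB _ _))// lerD//.
rewrite (le_trans (ler_normD _ _))// lerD//.
rewrite (le_trans (ler_normB _ _))// lerD//.
by rewrite (le_trans (ler_normD _ _))// lerD.
Qed.

Lemma CalGap0 (L : R) (S : {set 'I_m}) (q q' : m.-tuple R) :
  (forall a, a \in S -> tnth q' a = tnth q a) -> CalGap L S q q' = 0.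
Proof.
move=> qq'; rewrite /CalGap /norm2 big1 ?sqrtr0 ?mulr0// => -[a aS] _.
by rewrite /Defs.proj tnth_mktuple qq'// subrr expr0n.
Qed.

End error_decomposition.

(** * The error bound for the synthetic estimate *)

Theorem theorem3 (R : realType)
  (* full data: covariates, treatment, potential outcomes *)
  (d0 dX : measure_display) (Omega0 : measurableType d0)
  (P0 : probability Omega0 R) (TX : measurableType dX)
  (X : {RV P0 >-> TX}) (T : {RV P0 >-> bool}) (Y : bool -> {RV P0 >-> R})
  (e : TX -> R) (eta : R)
  (* workload *)
  (p k : nat) (phi : TX -> p.-tuple R) (extra : record TX R -> k.-tuple R)
  (B phimax Hq : R)
  (* estimator *)
  (S : {set 'I_(workload_size p k)})
  (dom : set ((workload_size p k).-tuple R)) (Lest : R)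
  (tau_est : (workload_size p k).-tuple R -> R)
  (* data, mechanism, solver, synthetic samples *)
  (d : measure_display) (Omega : measurableType d) (Pr : probability Omega R)
  (eps delta : nat -> R) (deltamax : R)
  (D : forall n : nat, {RV Pr >-> n.-tuple (record TX R)})
  (Z : nat -> {RV Pr >-> (workload_size p k).-tuple R})
  (Pref : probability (record TX R) R)
  (rho kappa : nat -> (workload_size p k).-tuple R -> R)
  (solver : nat ->
    {mfun (workload_size p k).-tuple R >-> pprobability (record TX R) R})
  (Dsyn : forall n N : nat, {RV Pr >-> N.-tuple (record TX R)}) :
  let m := workload_size p k in
  let h := workload phi extra in
  let valid := valid_record phi B phimax in
  let Pstar := observed_law X T Y in
  let tau := average_treatment_effect Y in
  let qstar := q_law h Pstar in
  let sigma n := gaussian_mechanism_scale h valid n (eps n) (delta n) in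
  let qD n o := q_data h (D n o) in
  let qtilde n o := tadd (qD n o) (Z n o) in
  let Psyn n o := solver n (qtilde n o) in
  let qPsyn n o := q_law h (Psyn n o) in
  let qDsyn n N o := q_data h (Dsyn n N o) in
  let tau_syn n N o := tau_est (qDsyn n N o) in
  let calgap n o := CalGap Lest S (qtilde n o) (qPsyn n o) in
  (* causal model *)
  cond_independent P0 (fun o => (Y true o, Y false o)) T X ->
  0 < eta ->
  is_cond_prob P0 X (T @^-1` [set true]) e ->
  {ae P0, forall o, eta <= e (X o) <= 1 - eta} ->
  {ae Pstar, forall w, valid w} ->
  (* workload *)
  (0 < p)%N ->
  measurable_fun setT phi ->
  measurable_fun setT extra ->
  (forall w, valid w -> norm2 (tnth (h w)) <= Hq) ->
  (* estimator *)
  0 <= Lest ->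
  moment_map_estimator dom S Lest tau_est ->
  dom qstar ->
  (forall n N, (0 < n)%N -> (0 < N)%N -> {ae Pr, forall o,
    [/\ dom (qD n o), dom (qtilde n o), dom (qPsyn n o) &
        dom (qDsyn n N o)]}) ->
  (* i.i.d. data *)
  (forall n, (0 < n)%N -> iid_sample Pr Pstar (D n)) ->
  (* Gaussian mechanism *)
  deltamax < 1 ->
  (forall n, 0 < eps n) ->
  (forall n, 0 < delta n <= deltamax) ->
  (forall n, (0 < n)%N -> iid_sample Pr (centered_gaussian (sigma n)) (Z n)) ->
  (forall n, (0 < n)%N -> independent_rv Pr (D n) (Z n)) ->
  (* reconstruction solver *)
  (forall n v, 0 <= rho n v /\ 0 <= kappa n v) ->
  (forall n, (0 < n)%N -> {ae Pr, forall o,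
    approx_KL_projection h valid Pref S (qtilde n o)
      (rho n (qtilde n o)) (kappa n (qtilde n o)) (Psyn n o)}) ->
  (* synthetic samples *)
  (forall n N, (0 < n)%N -> (0 < N)%N ->
    iid_draws_given Pr (qtilde n) (solver n) (Dsyn n N)) ->
  exists E1 E2 E3 : nat -> nat -> {RV Pr >-> R},
    [/\ bigOp Pr E1 (fun n _ => Lest * (Num.sqrt n%:R)^-1),
        bigOp Pr E2 (fun n _ =>
          Lest * Hq * Num.sqrt (ln m%:R * ln (1 / delta n)) /
          (n%:R * eps n)),
        bigOp Pr E3 (fun _ N => (Num.sqrt N%:R)^-1),
        (forall n N, (0 < n)%N -> (0 < N)%N -> {ae Pr, forall o,
          `|tau_syn n N o - tau| <=
          E1 n N o + E2 n N o + Approx tau tau_est qstar + E3 n N o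
          + calgap n o}) &
        forall n, (0 < n)%N ->
          {ae Pr, forall o, forall a, a \in S ->
            tnth (qPsyn n o) a = tnth (qtilde n o) a} ->
          {ae Pr, forall o, calgap n o = 0} /\
          (forall N, (0 < N)%N -> {ae Pr, forall o,
            `|tau_syn n N o - tau| <=
            E1 n N o + E2 n N o + Approx tau tau_est qstar + E3 n N o})].

Proof.
move=> m h valid Pstar tau qstar sigma qD qtilde Psyn qPsyn qDsyn tau_syn
  calgap.
move=> _ _ _ _ vPstar p0 mphi mextra hH L0 tauL dom_star dom_ae Diid dmax1 eps0
  delta_bd Ziid _ _ solver_ok Dsyn_draws.
pose I := {a : 'I_m | a \in S}.
(* [m >= 4 p >= 4], so [ln m > 0] and the noise rate does not degenerate through it. *)
have m1 : (1 < m)%N by rewrite /m /workload_size; lia.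
have mh : measurable_fun setT h by exact: measurable_workload.
have mvalid : measurable valid by exact: measurable_valid_record.
(* An event of probability one is nonempty; any valid record then forces [0 <= Hq]. *)
have valid0 : valid !=set0.
  apply/set0P/eqP => v0; have := ae_measure0 _ _ mvalid vPstar.
  rewrite v0 setC0; have /= -> := @probability_setT _ _ _ Pstar; move=> /eqP.
  by rewrite onee_eq0.
have Hq0 : 0 <= Hq.
  by have [w vw] := valid0; exact: le_trans (norm2_ge0 _ _) (hH w vw).
pose g (i : I) := truncated_query valid h Hq (val i).
have mg i : measurable_fun setT (g i) by exact: measurable_truncated_query.
have g0 i y : 0 <= g i y by exact: truncated_query_ge0.
have gc i y : g i y <= 2 * Hq by exact: truncated_query_le.
(* The release is the conditioning variable of the synthetic draws, so it has to be measurable. *)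
have mqtilde n : measurable_fun setT (qtilde n).
  apply/measurable_fun_tnthP => a.
  rewrite (_ : _ \o _ = fun o => n%:R^-1 *
      (\sum_(i < n) tnth (h (tnth (D n o) i)) a) + tnth (Z n o) a); last first.
    by apply/funext => o /=; rewrite !tnth_mktuple.
  apply: measurable_funD; last exact: (measurableT_comp (measurable_tnth a)).
  apply: measurable_funM => //; apply: measurable_sum => i.
  apply: (measurableT_comp (measurable_tnth a)); apply: (measurableT_comp mh).
  exact: (measurableT_comp (measurable_tnth i)).
(* With truncated queries these errors are controlled on all of [Omega]; they coincide with the
   actual errors almost surely, as [decomp] shows. *)
pose errD n := sampling_error g (fun _ : Omega => tt)
  (cst (Pstar : pprobability (record TX R) R)) (D n).
pose errSyn n N := sampling_error g (qtilde n) (solver n) (Dsyn n N).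
pose noise n o := Defs.proj S (Z n o).
have merrD n i : measurable_fun setT (fun o => errD n o i).
  by apply: (measurable_sampling_error g _ _ _ _ (2 * Hq)).
have merrSyn n N i : measurable_fun setT (fun o => errSyn n N o i).
  by apply: (measurable_sampling_error g _ _ _ _ (2 * Hq)).
have mnoise n i : measurable_fun setT (fun o => noise n o i).
  exact: (measurableT_comp (measurable_tnth (val i))).
have mE1 n : measurable_fun setT (fun o => Lest * normoo (errD n o)).
  by apply: measurable_funM => //; exact: measurable_normoo.
have mE2 n : measurable_fun setT (fun o => Lest * normoo (noise n o)).
  by apply: measurable_funM => //; exact: measurable_normoo.
have mE3 n N : measurable_fun setT (fun o => Lest * normoo (errSyn n N o)).
  by apply: measurable_funM => //; exact: measurable_normoo.
have iid_ok n : (0 < n)%N -> iid_draws_given Pr (fun _ : Omega => tt)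
    (cst (Pstar : pprobability (record TX R) R)) (D n).
  by move=> n0; apply: iid_draws_of_sample; exact: Diid.
have decomp n N : (0 < n)%N -> (0 < N)%N -> {ae Pr, forall o,
    `|tau_syn n N o - tau| <= Lest * normoo (errD n o) +
      Lest * normoo (noise n o) + Approx tau tau_est qstar +
      Lest * normoo (errSyn n N o) + calgap n o}.
  move=> n0 N0.
  have vD : {ae Pr, forall o, forall j, valid (tnth (D n o) j)}.
    apply: (ae_valid_draws _ _ _ _ _ _ _ _ _ _ _ _ mvalid (iid_ok n n0)) => //.
    exact: aeW.
  have vK : {ae Pr, forall o, {ae Psyn n o, forall w, valid w}}.
    by apply: filterS (solver_ok n n0) => o [].
  have vDsyn : {ae Pr, forall o, forall j, valid (tnth (Dsyn n N o) j)}.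
    exact: (ae_valid_draws _ _ _ _ _ _ _ _ _ _ _ _ mvalid
      (Dsyn_draws n N n0 N0)).
  apply: filterS2 (filterI (dom_ae n N n0 N0) vD) (filterI vK vDsyn).
  move=> o [[domD domt domP domS] vDo] [vKo vSo].
  (* On valid records, and for laws carried by them, the shifts by [Hq] cancel. *)
  have -> : errD n o = Defs.proj S (tsub (qD n o) qstar).
    apply/funext => i; rewrite /Defs.proj tnth_mktuple.
    rewrite (q_data_truncated valid h Hq _ (D n o))//.
    rewrite (q_law_truncated valid h Hq)//.
    by rewrite opprB addrA subrK.
  have -> : errSyn n N o = Defs.proj S (tsub (qDsyn n N o) (qPsyn n o)).
    apply/funext => i; rewrite /Defs.proj tnth_mktuple.
    rewrite (q_data_truncated valid h Hq _ (Dsyn n N o))//.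
    rewrite (q_law_truncated valid h Hq)//.
    by rewrite opprB addrA subrK.
  have -> : noise n o = Defs.proj S (tsub (qtilde n o) (qD n o)).
    by apply/funext => i; rewrite /noise /Defs.proj tnth_taddK.
  exact: (estimation_error_le dom).
have gap0 n : (0 < n)%N ->
    {ae Pr, forall o, forall a, a \in S ->
      tnth (qPsyn n o) a = tnth (qtilde n o) a} ->
    {ae Pr, forall o, calgap n o = 0}.
  by move=> n0; apply: filterS => o; exact: CalGap0.
have dmax0 : 0 < deltamax.
  by have /andP[d0' dm] := delta_bd 0%N; exact: lt_le_trans dm.
pose rate n := Hq * Num.sqrt (ln m%:R * ln (1 / delta n)) / (n%:R * eps n).
(* The strict inequality fails when [Lest = 0], so [Lest] can be cancelled. *)
have scale M x y : M * (Lest * x) < `|Lest * normoo y| -> M * x < normoo y.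
  rewrite ger0_norm ?mulr_ge0 ?normoo_ge0// mulrCA => LMx.
  have Lgt0 : 0 < Lest.
    by rewrite lt0r L0 andbT; apply: contraTneq LMx => ->; rewrite !mul0r ltxx.
  by rewrite -(ltr_pM2l Lgt0).
exists (fun n _ => rv_of Pr _ (mE1 n)), (fun n _ => rv_of Pr _ (mE2 n)),
  (fun n N => rv_of Pr _ (mE3 n N)); split.
- apply: (bigOp_uniform_tail Pr (fun n _ o => Lest * normoo (errD n o))
    (fun n _ o => normoo (errD n o)) _ (fun n _ => (Num.sqrt n%:R)^-1) 1) => //.
  + by move=> n _; exact: measurable_normoo.
  + by move=> n N o M M0; rewrite mul1r; exact: scale.
  + apply: (uniform_tail_sampling_error Pr _ _ _ g (2 * Hq) (fun n _ => n)
      (fun _ _ _ => tt) (fun _ _ => cst (Pstar : pprobability (record TX R) R))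
      (fun n _ => D n)) => // n N n0 _.
    exact: iid_ok.
- apply: (bigOp_uniform_tail Pr (fun n _ o => Lest * normoo (noise n o))
    (fun n _ o => normoo (noise n o)) _ (fun n _ => rate n) 1) => //.
  + by move=> n _; exact: measurable_normoo.
  + move=> n N o M M0; rewrite mul1r.
    rewrite (_ : Lest * Hq * _ / _ = Lest * rate n); first exact: scale.
    by rewrite /rate !mulrA.
  + have [C C0 lnC] := ln_ratio_bound m deltamax m1 dmax0 dmax1.
    (* The 2 is that of the sensitivity bound [2 Hq / n]; [C] compares the logarithms. *)
    apply: (gaussian_noise_uniform_tail _ _ _ _ _ val (fun n => Z n) sigma rate
      (2 * C)) => // [|n n0]; first exact: mulr_gt0.
    have /andP[s0 sH] := sensitivity_bound _ _ _ h valid Hq n n0 valid0 hH.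
    rewrite /sigma /gaussian_mechanism_scale; apply/andP; split.
      by rewrite divr_ge0 ?mulr_ge0 ?sqrtr_ge0// ltW.
    rewrite ler_pdivrMr//.
    apply: (le_trans (ler_pM s0 (sqrtr_ge0 _) sH (lnC _ (delta_bd n)))).
    rewrite le_eqVlt /rate; apply/orP; left; apply/eqP.
    by field; rewrite gt_eqF// pnatr_eq0 -lt0n.
(* This rate is free of [Lest], so the constant carries it; [Lest + 1] is positive even when
   [Lest = 0]. *)
- apply: (bigOp_uniform_tail Pr (fun n N o => Lest * normoo (errSyn n N o))
    (fun n N o => normoo (errSyn n N o)) _ (fun _ N => (Num.sqrt N%:R)^-1)
    (Lest + 1)) => //.
  + by rewrite ltr_wpDl.
  + by move=> n N; exact: measurable_normoo.
  + move=> n N o M M0; rewrite ger0_norm ?mulr_ge0 ?normoo_ge0//.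
    have s0 : 0 <= (Num.sqrt N%:R)^-1 :> R by rewrite invr_ge0 sqrtr_ge0.
    rewrite !ltNge; apply: contra => nM.
    rewrite (le_trans (ler_wpM2l L0 nM))// -mulrA ler_wpM2r ?lerDl//.
    by rewrite mulr_ge0// ltW.
  + exact: (uniform_tail_sampling_error Pr _ _ _ g (2 * Hq) (fun _ N => N)
      (fun n _ => qtilde n) (fun n _ => solver n) (fun n N => Dsyn n N)).
- exact: decomp.
(* The same three errors serve the exact case, where the gap is almost surely zero. *)
- move=> n n0 exact_n; have cg := gap0 n n0 exact_n; split => // N N0.
  apply: filterS2 (decomp n N n0 N0) cg => o + cg0.
  by rewrite cg0 addr0.
Qed.
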